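(* Let $\alpha,\beta>\frac12$. For every $N$ let $-1=x_0<x_1<\dots<x_N=1$ be a set of nodes (depending on $N$) with $h_i=x_i-x_{i-1}$, and assume that the mesh is quasi-uniform, i.e. there exist constants $c_h,C_h>0$, independent of $N$, such that $\frac{c_h}{N}\le h_i\le\frac{C_h}{N}$ for $i=1,\dots,N$. Let $H_N\in\mathbb{R}^{N\times N}$ be the associated weighted Jacobi histopolation matrix with respect to the basis $P^{(\alpha+1,\beta+1)}_{j-1}$, $j=1,\dots,N$ (see context). Then, for any fixed $\gamma>0$, $$\left\{\frac{H_N}{(\log N)^\gamma}\right\}_N\sim_{\mathrm{GLT}}0 .$$
   Context: For $\alpha,\beta>-1$, $\omega_{\alpha,\beta}(t)=(1-t)^\alpha(1+t)^\beta$ on $[-1,1]$, and $P_j^{(\alpha,\beta)}$ is the Jacobi polynomial of degree $j$, orthogonal on $[-1,1]$ with respect to $\omega_{\alpha,\beta}$, with the standard normalization $P_j^{(\alpha,\beta)}(1)=\frac{\Gamma(j+\alpha+1)}{\Gamma(j+1)\Gamma(\alpha+1)}$. With $s_i=[x_{i-1},x_i]$, $$[H_N]_{i,j}=\frac1{h_i}\int_{s_i}P^{(\alpha+1,\beta+1)}_{j-1}(t)\,\omega_{\alpha,\beta}(t)\,dt,\quad i,j=1,\dots,N.$$ For a sequence of matrices $Z_N\in\mathbb{C}^{N\times N}$ (here $N\ge2$), $\{Z_N\}_N\sim_{\mathrm{GLT}}0$ (GLT sequence with symbol $0$) is equivalent to, and may be taken as defined by, $\{Z_N\}_N$ being zero-distributed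 ($\{Z_N\}_N\sim_\sigma0$): for every $F\in C_c(\mathbb{R})$, $\lim_{N\to\infty}\frac1N\sum_{i=1}^NF(\sigma_i(Z_N))=F(0)$, where $\sigma_i$ are the singular values; equivalently, for every $\varepsilon>0$, $\lim_{N\to\infty}\frac1N\#\{i:\sigma_i(Z_N)>\varepsilon\}=0$. *)

(* Defs.v *)
From HB Require Import structures.
From mathcomp Require Import all_boot all_order all_algebra.
From mathcomp Require Import complex.
From mathcomp Require Import all_classical all_reals all_analysis.

Set Implicit Arguments.
Unset Strict Implicit.
Unset Printing Implicit Defensive.

Import Order.TTheory GRing.Theory Num.Theory.
Import numFieldNormedType.Exports.

Local Open Scope classical_set_scope.
Local Open Scope complex_scope.
Local Open Scope sesquilinear_scope.
Local Open Scope ring_scope.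

(* Euler's integral; meant for 0 < s (the Rintegral is a junk value where the
   integral diverges). *)
Definition Gamma (R : realType) (s : R) : R :=
  \int[lebesgue_measure]_(t in `]0, +oo[) (t `^ (s - 1) * expR (- t)).

Definition jacobi_weight (R : realType) (a b t : R) : R :=
  (1 - t) `^ a * (1 + t) `^ b.

(* The three clauses determine the family (P j)_j uniquely when -1 < a, b.
   Recall that size p = (degree p).+1. *)
Definition jacobi_polynomials (R : realType) (a b : R) (P : nat -> {poly R}) :
    Prop :=
  [/\ forall j, size (P j) = j.+1,
      forall j k, j <> k ->
        \int[lebesgue_measure]_(t in `[-1, 1])
          ((P j).[t] * (P k).[t] * jacobi_weight a b t) = 0
    & forall j, (P j).[1] =
        Gamma (j%:R + a + 1) / (Gamma (j%:R + 1) * Gamma (a + 1))].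

(* For each N, the nodes are x N 0, ..., x N N; the values x N i with N < i are
   irrelevant. *)
Definition mesh (R : realType) (N : nat) (x : nat -> R) : Prop :=
  [/\ x 0%N = -1, x N = 1 & forall i, (i < N)%N -> x i < x i.+1].

Definition quasi_uniform (R : realType) (x : nat -> nat -> R) : Prop :=
  exists c C : R, [/\ 0 < c, 0 < C &
    forall N i, (1 < N)%N -> (i < N)%N ->
      c / N%:R <= x N i.+1 - x N i <= C / N%:R].

(* Ordinals start at 0: row i is the cell [x i, x i.+1] and column j is the
   basis polynomial P j of degree j. *)
Definition histopolation_mx (R : realType) (a b : R) (P : nat -> {poly R})
    (N : nat) (x : nat -> R) : 'M[R]_N :=
  \matrix_(i < N, j < N)
    ((x i.+1 - x i)^-1 *
     \int[lebesgue_measure]_(t in `[x i, x i.+1])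
       ((P j).[t] * jacobi_weight a b t)).

(* Z^* Z is Hermitian, hence normal, so its spectral_diag lists its eigenvalues
   with multiplicity, and these are real and nonnegative. *)
Definition singular_value (R : realType) (N : nat) (Z : 'M[R[i]]_N) (i : 'I_N) :
    R :=
  Num.sqrt (complex.Re (spectral_diag (Z^t* *m Z) 0 i)).

Definition zero_distributed (R : realType) (Z : forall N, 'M[R[i]]_N) : Prop :=
  forall F : R -> R, continuous F -> compact (closure [set t | F t != 0]) ->
    (fun N : nat => N%:R^-1 * \sum_(i < N) F (singular_value (Z N) i))
      @ \oo --> F 0.

(* For the symbol 0, being a GLT sequence is equivalent to being
   zero-distributed, which serves here as its definition. *)
Definition GLT0 (R : realType) (Z : forall N, 'M[R[i]]_N) : Prop :=
  zero_distributed Z.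

(* Main.v *)
Require Import Defs.
From HB Require Import structures.
From mathcomp Require Import all_boot all_order all_algebra.
From mathcomp Require Import complex.
From mathcomp Require Import all_classical all_reals all_analysis.
From mathcomp Require Import measurable_realfun.
From mathcomp Require Import ring lra.

Set Implicit Arguments.
Unset Strict Implicit.
Unset Printing Implicit Defensive.

Import Order.TTheory GRing.Theory Num.Theory.
Import numFieldNormedType.Exports.

Local Open Scope classical_set_scope.
Local Open Scope complex_scope.
Local Open Scope sesquilinear_scope.
Local Open Scope ring_scope.

(** A sequence of matrices is zero-distributed as soon as, for every e > 0, the
    N-th matrix is eventually the sum of a matrix of rank at most e N and one of
    squared Frobenius norm at most e N ([zero_distributed_lowrank_small]): the
    singular values above d then number at most e N + e N / d^2, because the
    matrix agrees with its small part on the span of the corresponding singular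
    vectors intersected with the kernel of the low-rank part.

    The histopolation matrix H is split by cutting out the first k columns and
    the first and last k rows, where k is about N / q with q fixed; the frame
    cut out has rank at most 3 k.  The kept rows belong to cells at distance at
    least c / q from -1 and 1, and there the square of the weight
    w_(alpha,beta) is at most a constant times w_(alpha+1,beta+1), for which the
    basis is orthogonal.  Since the h_i are at least c / N, Cauchy-Schwarz on
    each cell bounds the sum of the squares of a kept column j by a constant
    times N |P_j|^2, with |P_j| the norm in L^2(w_(alpha+1,beta+1))
    ([sum_kept_sqr]).  Since |P_j|^2 = O(1/j) ([sqnorm_bound]), the kept
    columns, of degree j >= N / q, contribute O(N) in total
    ([kept_block_frobenius]).  Dividing H by (log N)^gamma divides this by
    (log N)^(2 gamma), which makes it o(N) for every gamma > 0.  The columns of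
    small degree have to be treated as a low-rank part: the harmonic sum over
    all degrees would cost a factor log N, hence only allow gamma > 1/2.

    The bound |P_j|^2 = O(1/j), for exponents a = alpha + 1 and b = beta + 1,
    is obtained from an exact first-order recurrence ([sqnorm_recurrence]):
    S_j = (2 j + 1 + a + b) |P_j|^2 is multiplied at step n = j + 1 by
      (n + a) (n + b) / (n (n + a + b)) = 1 + a b / (n (n + a + b)),
    and the product of these factors converges.  The recurrence is derived by
    integration by parts from orthogonality and from the ratio of the values
    P_n(1), P_j(1), which the functional equation of Gamma ([GammaS])
    provides. *)

(** * Counting eigenvalues above a threshold *)

Definition frobenius2 (C : numClosedFieldType) m n (A : 'M[C]_(m, n)) : C :=
  \sum_i \sum_j `|A i j| ^+ 2.

Lemma frobenius2E (C : numClosedFieldType) m n (A : 'M[C]_(m, n)) :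
  frobenius2 A = mxtrace (A *m A^t*).
Proof.
apply: eq_bigr => i _; rewrite mxE; apply: eq_bigr => j _.
by rewrite !mxE normCK.
Qed.

Lemma frobenius2_ge0 (C : numClosedFieldType) m n (A : 'M[C]_(m, n)) :
  0 <= frobenius2 A.
Proof.
by apply: sumr_ge0 => i _; apply: sumr_ge0 => j _; rewrite exprn_ge0.
Qed.

Lemma trmxC_mul (C : numClosedFieldType) m n p (A : 'M[C]_(m, n))
    (B : 'M[C]_(n, p)) : (A *m B)^t* = B^t* *m A^t*.
Proof. by rewrite trmx_mul map_mxM. Qed.

(** Bessel's inequality applied to every row of A: the difference of the two
    sides is the squared norm of A minus its projection on the rows of W. *)
Lemma frobenius2_mul_unitary (C : numClosedFieldType) m n p
    (A : 'M[C]_(m, n)) (W : 'M[C]_(p, n)) :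
  W \is unitarymx -> frobenius2 (A *m W^t*) <= frobenius2 A.
Proof.
move=> /unitarymxP WW; rewrite -subr_ge0.
suff -> : frobenius2 A - frobenius2 (A *m W^t*)
    = frobenius2 (A - A *m (W^t* *m W)) by exact: frobenius2_ge0.
rewrite !frobenius2E.
have -> : (A - A *m (W^t* *m W))^t* = A^t* - W^t* *m W *m A^t*.
  by rewrite linearB /= map_mxB !trmxC_mul trmxCK. 
rewrite !trmxC_mul trmxCK mulmxBl !mulmxBr.
have -> : A *m (W^t* *m W) *m (W^t* *m W *m A^t*) =
    A *m W^t* *m (W *m W^t*) *m (W *m A^t*) by rewrite !mulmxA.
rewrite WW mulmx1.
by rewrite !mulmxA subrr subr0 linearB.
Qed.

Lemma mxtrace_conj_diag (C : numClosedFieldType) m n (Y : 'M[C]_(m, n)) d :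
  mxtrace (Y *m diag_mx d *m Y^t*) = \sum_i \sum_j `|Y i j| ^+ 2 * d 0 j.
Proof.
apply: eq_bigr => i _; rewrite mxE; apply: eq_bigr => j _.
rewrite mul_mx_diag !mxE normCK mulrAC; congr (_ * _).
Qed.

(** The eigenvectors for S span a space of dimension #|S| on which
    v |-> |(A + B) v|^2 is at least e |v|^2.  Its intersection with the kernel
    of B has dimension at least #|S| - rank B, and there A + B is A; summing
    |A v|^2 over an orthonormal basis of the intersection gives at most the
    squared Frobenius norm of A. *)
Lemma spectral_count (C : numClosedFieldType) n (A B : 'M[C]_n) (e : C)
    (S : {set 'I_n}) : 0 < e ->
  (forall i, i \in S -> e <= spectral_diag ((A + B)^t* *m (A + B)) 0 i) ->
  e * #|S|%:R <= e * (\rank B)%:R + frobenius2 A.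
Proof.
move=> e0 eS; set Z := A + B in eS *; set G := Z^t* *m Z in eS *.
have Gn : G \is normalmx.
  by apply/normalmxP; rewrite /G !trmxC_mul !trmxCK.
have := orthomx_spectralP Gn; rewrite invmx_unitary ?spectral_unitarymx //.
set U := spectralmx G; set d := spectral_diag G => GE.
have /unitarymxP UU : U \is unitarymx by apply: spectral_unitarymx.
(* The rows of M are the adjoints of the selected eigenvectors. *)
pose M : 'M[C]_(#|S|, n) := rowsub (@enum_val _ (mem S)) U.
pose dS := \row_j d 0 (@enum_val _ (mem S) j).
have ME : M = rowsub (@enum_val _ (mem S)) 1%:M *m U.
  by rewrite mul_rowsub_mx mul1mx.
have MU : M *m U^t* = rowsub (@enum_val _ (mem S)) 1%:M.
  by rewrite ME -mulmxA UU mulmx1.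
have Mu : M \is unitarymx.
  apply/unitarymxP; rewrite {2}ME trmxC_mul mulmxA MU.
  apply/matrixP=> i j; rewrite !mxE (bigD1 (enum_val i)) //=.
  rewrite big1 ?addr0; last first.
    by move=> k ki; rewrite !mxE eq_sym (negbTE ki) mul0r.
  by rewrite !mxE eqxx mul1r conjC_nat (inj_eq enum_val_inj) eq_sym.
have MG : M *m G *m M^t* = diag_mx dS.
  rewrite GE !mulmxA MU -!mulmxA.
  have -> : U *m M^t* = (M *m U^t*)^t* by rewrite trmxC_mul trmxCK.
  rewrite MU; apply/matrixP=> i j; rewrite mul_rowsub_mx mul1mx !mxE.
  rewrite (bigD1 (enum_val j)) //= big1 ?addr0; last first.
    move=> k kj; rewrite !mxE [enum_val j == k]eq_sym (negbTE kj).
    by rewrite conjC0 mulr0.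
  by rewrite !mxE eqxx conjC1 mulr1 (inj_eq enum_val_inj); case: eqP => // ->.
(* Coordinates, in the rows of M, of the vectors that B annihilates. *)
pose K := kermx (M *m B^t*).
have Kr : (#|S| <= \rank B + \rank K)%N.
  rewrite mxrank_ker -leq_subLR leq_sub2l //.
  apply: leq_trans (mxrankM_maxr _ _) _.
  by rewrite mxrank_map mxrank_tr.
pose Y := schmidt (row_base K).
have Yu : Y \is unitarymx by apply: schmidt_unitarymx; apply: rank_leq_row.
have YK : Y *m (M *m B^t*) = 0.
  apply/sub_kermxP; rewrite /Y.
  by rewrite eqmx_schmidt_free ?row_base_free ?rank_leq_row // eq_row_base.
pose W := Y *m M.
have Wu : W \is unitarymx by apply: mul_unitarymx.
have ZW : Z *m W^t* = A *m W^t*.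
  have : (W *m B^t*)^t* = 0 by rewrite /W -mulmxA YK trmx0 map_mx0.
  by rewrite trmxC_mul trmxCK mulmxDl => ->; rewrite addr0.
have trW : frobenius2 (A *m W^t*) = mxtrace (Y *m diag_mx dS *m Y^t*).
  rewrite frobenius2E -ZW mxtrace_mulC trmxC_mul trmxCK -MG /W trmxC_mul.
  by rewrite /G !mulmxA.
have le1 : e * (\rank K)%:R <= frobenius2 (A *m W^t*).
  rewrite trW mxtrace_conj_diag.
  apply: (@le_trans _ _ (e * frobenius2 Y)).
    by rewrite frobenius2E (unitarymxP Yu) mxtrace1.
  rewrite /frobenius2 mulr_sumr; apply: ler_sum => i _.
  rewrite mulr_sumr; apply: ler_sum => j _.
  rewrite mulrC ler_wpM2l ?exprn_ge0 // mxE eS //.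
  by have := enum_valP j.
apply: (@le_trans _ _ (e * (\rank B + \rank K)%:R)).
  by rewrite ler_wpM2l ?ler_nat // ltW.
rewrite natrD mulrDr lerD2l; apply: le_trans le1 _.
exact: frobenius2_mul_unitary.
Qed.

Lemma mxrank_zero_rows (F : fieldType) m n (A : 'M[F]_(m, n))
    (p : {pred 'I_m}) :
  (forall i j, i \notin p -> A i j = 0) -> (\rank A <= #|p|)%N.
Proof.
move=> A0.
pose f : 'I_#|p| -> 'I_m := @enum_val _ p.
have -> : A = (rowsub f 1%:M)^T *m rowsub f A.
  apply/matrixP=> i j; rewrite !mxE.
  under eq_bigr do rewrite !mxE.
  case: (boolP (i \in p)) => ip.
    have fi : f (enum_rank_in ip i) = i by exact: enum_rankK_in.
    rewrite (bigD1 (enum_rank_in ip i)) //= fi eqxx mul1r.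
    rewrite big1 ?addr0 // => k ki; case: eqP => [ki'|]; last by rewrite mul0r.
    by case/eqP: ki; apply: (@enum_val_inj _ p); rewrite -[LHS]/(f k) ki'.
  rewrite A0 // big1 // => k _; case: eqP => [ki'|]; last by rewrite mul0r.
  by case/negP: ip; rewrite -ki'; apply: enum_valP.
by apply: leq_trans (mxrankM_maxr _ _) (rank_leq_row _).
Qed.

(** * A criterion for zero distribution *)

Lemma large_singular_values (R : realType) n (A B : 'M[R[i]]_n) (d r s : R) :
  0 < d -> (\rank B)%:R <= r -> frobenius2 A <= s%:C ->
  #|[set i | d <= singular_value (A + B) i]%SET|%:R <= r + s / d ^+ 2.
Proof.
move=> d0 Br As; set S := [set i | _]%SET.
have d20 : 0 < d ^+ 2 by rewrite exprn_gt0.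
have d2C : 0 < (d ^+ 2)%:C by rewrite ltcR.
have : (d ^+ 2)%:C * #|S|%:R <= (d ^+ 2)%:C * (\rank B)%:R + frobenius2 A.
  apply: spectral_count => // i; rewrite inE /singular_value.
  set G := _ *m _; set x := spectral_diag G 0 i => dx.
  have xr : x \is Num.real.
    apply: (mxOverP (hermitian_spectral_diag_real _)); apply/is_hermitianmxP.
    by rewrite expr0 scale1r /G trmxC_mul trmxCK.
  rewrite -(RRe_real xr) lecR.
  rewrite leNgt; apply/negP => xd.
  suff : Num.sqrt (complex.Re x) < d by rewrite ltNge dx.
  by rewrite -(gtr0_norm d0) -sqrtr_sqr ltr_sqrt.
move=> /le_trans /(_ (lerD (lexx _) As)).
rewrite -!(rmorph_nat (real_complex R)) -!rmorphM -!rmorphD lecR => h.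
rewrite -(ler_pM2l d20) mulrDr mulrCA divff ?gt_eqF // mulr1.
apply: le_trans h _; rewrite lerD2r ler_pM2l //.
Qed.

Lemma compact_support_bounded (R : realType) (F : R -> R) :
  continuous F -> compact (closure [set t | F t != 0]) ->
  exists2 M, 0 < M & forall t, `|F t| <= M.
Proof.
move=> cF cK.
have := compact_bounded (continuous_compact (continuous_subspaceT cF) cK).
case=> M [Mr]  /(_ (`|M| + 1)) H; exists (`|M| + 1); first by rewrite ltr_wpDl.
move=> t; have [->|Ft] := eqVneq (F t) 0.
  by rewrite normr0 addr_ge0.
apply: H; first by rewrite (le_lt_trans (ler_norm _)) // ltrDl.
by exists t => //; apply: subset_closure.
Qed.

(** For a test function F bounded by M, the singular values below the modulus of
    continuity of F at 0 contribute at most half the tolerance to the mean of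
    F - F 0, and the others at most 2 M times their proportion. *)
Lemma zero_distributed_lowrank_small (R : realType) (Z : forall N, 'M[R[i]]_N) :
  (forall e : R, 0 < e -> \forall N \near \oo,
     exists A B : 'M[R[i]]_N, [/\ Z N = A + B, (\rank B)%:R <= e * N%:R
       & frobenius2 A <= (e * N%:R)%:C]) ->
  zero_distributed Z.
Proof.
move=> H F cF cK.
have [M M0 FM] := compact_support_bounded cF cK.
apply/cvgrPdist_le => e e0.
have e20 : 0 < e / 2 by rewrite divr_gt0.
have /cvgrPdist_lt /(_ _ e20) := cF 0.
move=> /nbhs_ballP [d /= d0 Fd].
pose c := e / 2 / (2 * M * (1 + d ^- 2)).
have k0 : 0 < 2 * M * (1 + d ^- 2).
  by rewrite !mulr_gt0 // addr_gt0 // invr_gt0 exprn_gt0.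
have c0 : 0 < c by rewrite divr_gt0.
near=> N.
have N0 : (0 < N)%N by near: N; exact: nbhs_infty_gt.
have NR : 0 < N%:R :> R by rewrite ltr0n.
have [A [B [ZE Br As]]] : exists A B : 'M[R[i]]_N,
    [/\ Z N = A + B, (\rank B)%:R <= c * N%:R & frobenius2 A <= (c * N%:R)%:C].
  by near: N; exact: H.
have := large_singular_values d0 Br As; rewrite -ZE.
set S := [set i | _]%SET => Sle.
have -> : F 0 = N%:R^-1 * \sum_(i < N) F 0.
  by rewrite sumr_const card_ord -[F 0 *+ N]mulr_natl mulKf // gt_eqF.
rewrite -mulrBr -sumrB normrM gtr0_norm ?invr_gt0 //.
rewrite ler_pdivrMl //.
apply: le_trans (ler_norm_sum _ _ _) _.
apply: (@le_trans _ _ (\sum_(i < N) (e / 2 + (2 * M) *+ (i \in S)))).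
  apply: ler_sum => i _; case: (boolP (i \in S)) => iS.
    apply: (@le_trans _ _ (2 * M)); last by rewrite mulr1n lerDr ltW.
    by rewrite mulr_natl mulr2n (le_trans (ler_normB _ _)) // lerD.
  rewrite mulr0n addr0 ltW //; apply: Fd.
  rewrite /ball /= sub0r normrN ger0_norm ?sqrtr_ge0 //.
  by rewrite ltNge; move: iS; rewrite inE.
rewrite big_split /= sumr_const card_ord -[e / 2 *+ N]mulr_natl.
have -> : \sum_(i < N) (2 * M) *+ (i \in S) = 2 * M * #|S|%:R.
  rewrite -sum1_card natr_sum mulr_sumr [RHS]big_mkcond /=.
  by apply: eq_bigr => i _; case: (i \in S); rewrite ?mulr1 ?mulr1n ?mulr0n.
rewrite (le_trans (lerD (lexx _) (ler_wpM2l _ Sle))) //.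
  by rewrite mulr_ge0 // ltW.
have -> : c * N%:R + c * N%:R / d ^+ 2 = c * (1 + d ^- 2) * N%:R.
  by rewrite mulrDr mulr1 mulrDl -!mulrA [d ^- 2 * _]mulrC.
have -> : 2 * M * (c * (1 + d ^- 2) * N%:R) = e / 2 * N%:R.
  have -> : 2 * M * (c * (1 + d ^- 2) * N%:R) =
      c * (2 * M * (1 + d ^- 2)) * N%:R.
    by ring.
  by rewrite /c divfK // gt_eqF.
by rewrite mulrC -mulrDl -splitr mulrC.
Unshelve. all: by end_near.
Qed.

(** * Recurrence for the norms of a Jacobi-type orthogonal family *)

Lemma horner1BX (R : comNzRingType) (t : R) : (1 - 'X : {poly R}).[t] = 1 - t.
Proof. by rewrite !hornerE. Qed.

Lemma horner1DX (R : comNzRingType) (t : R) : (1 + 'X : {poly R}).[t] = 1 + t.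
Proof. by rewrite !hornerE. Qed.

Section linear_functionals.
Context {R : realFieldType}.
Implicit Types (c : R) (p q : {poly R}).

Lemma linear_forD (T : {poly R} -> R) p q :
  linear_for *%R T -> T (p + q) = T p + T q.
Proof. by move=> /(_ 1 p q); rewrite scale1r mul1r. Qed.

Lemma linear_for0 (T : {poly R} -> R) : linear_for *%R T -> T 0 = 0.
Proof. by move=> lT; apply: (addrI (T 0)); rewrite -linear_forD // !addr0. Qed.

Lemma linear_forZ (T : {poly R} -> R) c p :
  linear_for *%R T -> T (c *: p) = c * T p.
Proof.
by move=> lT; have := lT c p 0; rewrite (linear_for0 lT) !addr0.
Qed.

Lemma linear_forN (T : {poly R} -> R) p : linear_for *%R T -> T (- p) = - T p.
Proof. by move=> lT; rewrite -scaleN1r linear_forZ // mulN1r. Qed.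

(** The first n polynomials of a family with one member of each degree span all
    polynomials of size at most n. *)
Lemma functional_low_degree_eq0 (T : {poly R} -> R) (P : nat -> {poly R}) n q :
  (forall j, size (P j) = j.+1) ->
  linear_for *%R T ->
  (forall k, (k < n)%N -> T (P k) = 0) -> (size q <= n)%N -> T q = 0.
Proof.
move=> sP lT; elim: n q => [|n IH] q TP sq.
  move: sq; rewrite leqn0 size_poly_eq0 => /eqP ->.
  exact: linear_for0.
have lP : (P n)`_n != 0.
  by have := lead_coef_eq0 (P n); rewrite /lead_coef -size_poly_eq0 sP /= => ->.
pose c := q`_n / (P n)`_n.
have -> : q = (q - c *: P n) + c *: P n by rewrite subrK.
rewrite linear_forD // linear_forZ // TP // mulr0 addr0; apply: IH.
  by move=> k kn; rewrite TP // ltnW.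
apply/leq_sizeP => k; rewrite leq_eqVlt => /predU1P[<-|nk].
  by rewrite coefB coefZ divfK // subrr.
by rewrite coefB coefZ !nth_default ?mulr0 ?subr0 ?sP // (leq_trans sq).
Qed.

Lemma split_at p x : exists2 r, p = p.[x]%:P + ('X - x%:P) * r &
  (size r <= (size p).-1)%N.
Proof.
have /factor_theorem[r pr] : root (p - p.[x]%:P) x.
  by rewrite rootE !hornerE subrr.
exists r; first by rewrite mulrC -pr addrC subrK.
have [->|r0] := eqVneq r 0; first by rewrite size_poly0.
have sr : size (p - p.[x]%:P) = (size r).+1.
  by rewrite pr size_Mmonic ?monicXsubC // size_XsubC addn2.
have [p0|p1] := leqP (size p) 1.
  move: sr; rewrite (size1_polyC p0) hornerC subrr size_poly0 //.
rewrite -ltnS -sr prednK; last exact: ltnW.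
apply: leq_trans (size_polyD _ _) _; rewrite geq_max leqnn size_polyN.
by rewrite (leq_trans (size_polyC_leq1 _)) // ltnW.
Qed.

End linear_functionals.

(** I, Ia and Ib stand for integration against the Jacobi weight with exponents
    (a, b), (a - 1, b) and (a, b - 1). *)
Section orthogonal_family.
Context {R : realFieldType} (a b : R) (a0 : 0 < a) (b0 : 0 < b).
Context (I Ia Ib : {poly R} -> R).
Context (linI : linear_for *%R I) (linIa : linear_for *%R Ia)
  (linIb : linear_for *%R Ib).
Context (Ia_mul1BX : forall p, Ia ((1 - 'X) * p) = I p)
  (Ib_mul1DX : forall p, Ib ((1 + 'X) * p) = I p)
  (I_deriv : forall p, I p^`() = a * Ia p - b * Ib p)
  (I_gt0 : forall p, p != 0 -> 0 < I (p * p)).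
Context (P : nat -> {poly R}) (sP : forall j, size (P j) = j.+1).
Context (oP : forall j k, j <> k -> I (P j * P k) = 0).
Implicit Types (p q r : {poly R}) (j k n : nat).

Let ID p q : I (p + q) = I p + I q. Proof. exact: linear_forD. Qed.
Let IN p : I (- p) = - I p. Proof. exact: linear_forN. Qed.
Let IZ c p : I (c *: p) = c * I p. Proof. exact: linear_forZ. Qed.
Let IaD p q : Ia (p + q) = Ia p + Ia q. Proof. exact: linear_forD. Qed.
Let IaN p : Ia (- p) = - Ia p. Proof. exact: linear_forN. Qed.
Let IaZ c p : Ia (c *: p) = c * Ia p. Proof. exact: linear_forZ. Qed.
Let IbD p q : Ib (p + q) = Ib p + Ib q. Proof. exact: linear_forD. Qed.
Let IbN p : Ib (- p) = - Ib p. Proof. exact: linear_forN. Qed.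
Let IbZ c p : Ib (c *: p) = c * Ib p. Proof. exact: linear_forZ. Qed.

Definition sqnorm j := I (P j * P j).
(* B j and E j integrate P j against the weight with one exponent lowered, that
   is, with an additional factor 1 / (1 - t), respectively 1 / (1 + t). *)
Let B j := Ia (P j).
Let E j := Ib (P j).

Lemma orth_low j q : (size q <= j)%N -> I (P j * q) = 0.
Proof.
apply: (functional_low_degree_eq0 (T := fun q => I (P j * q)) sP).
- by move=> c p r; rewrite mulrDr -scalerAr linI.
- by move=> k kj; apply: oP => jk; rewrite jk ltnn in kj.
Qed.

Lemma orth_eq0 n r : (size r <= n)%N ->
  (forall k, (k < n)%N -> I (r * P k) = 0) -> r = 0.
Proof.
move=> sr rP; apply/eqP/negPn/negP => r0.
have := I_gt0 r0.
rewrite (functional_low_degree_eq0 (T := fun q => I (r * q)) sP _ rP sr) ?ltxx //.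
by move=> c p q; rewrite mulrDr -scalerAr linI.
Qed.

Lemma sqnorm_gt0 j : 0 < sqnorm j.
Proof. by apply: I_gt0; rewrite -size_poly_eq0 sP. Qed.

(** In q = q(-1) + (1 + X) r the second part restores the full exponent b and
    is killed by orthogonality.  In particular q |-> Ib (P j * q) is evaluation
    at -1 up to the factor E j; likewise Ia evaluates at 1. *)
Lemma Ib_mul j q : (size q <= j.+1)%N -> Ib (P j * q) = q.[-1] * E j.
Proof.
move=> sq; have [r qr sr] := split_at q (-1).
rewrite {1}qr mulrDr IbD mulrC mul_polyC IbZ.
have -> : P j * (('X - (-1)%:P) * r) = (1 + 'X) * (P j * r).
  by rewrite polyCN opprK polyC1; ring.
rewrite Ib_mul1DX orth_low ?addr0 //.
by apply: leq_trans sr _; case: (size q) sq.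
Qed.

Lemma Ia_mul j q : (size q <= j.+1)%N -> Ia (P j * q) = q.[1] * B j.
Proof.
move=> sq; have [r qr sr] := split_at q 1.
rewrite {1}qr mulrDr IaD mulrC mul_polyC IaZ.
have -> : P j * (('X - 1%:P) * r) = - ((1 - 'X) * (P j * r)).
  by rewrite polyC1; ring.
rewrite IaN Ia_mul1BX orth_low ?oppr0 ?addr0 //.
by apply: leq_trans sr _; case: (size q) sq.
Qed.

Lemma Ib_1BX p : Ib ((1 - 'X) * p) = 2 * Ib p - I p.
Proof.
have -> : (1 - 'X) * p = 2%:P * p - (1 + 'X) * p.
  by rewrite polyCMn polyC1; ring.
by rewrite IbD IbN mul_polyC IbZ Ib_mul1DX.
Qed.

(** Integration by parts with the factor 1 - X, which cancels the pole at 1 of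
    the logarithmic derivative of the weight and leaves only the one at -1. *)
Lemma by_parts p q : I ((1 - 'X) * p^`() * q) =
  (1 + a + b) * I (p * q) - I (p * ((1 - 'X) * q^`())) - 2 * b * Ib (p * q).
Proof.
have := I_deriv ((1 - 'X) * (p * q)); rewrite Ib_1BX Ia_mul1BX.
have -> : ((1 - 'X) * (p * q))^`() =
    - (p * q) + (1 - 'X) * p^`() * q + p * ((1 - 'X) * q^`()).
  by rewrite !derivM derivB derivC derivX; ring.
rewrite !ID IN => H.
lra.
Qed.

(* The terms of degree j cancel.  For k < j the inner products with P k turn out
   to be proportional to P_k(-1): D j is a multiple of the kernel polynomial of
   degree j - 1 at -1. *)
Let D j := (1 - 'X) * (P j)^`() + j%:R *: P j.

Lemma size_D j : (size (D j) <= j)%N.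
Proof.
apply/leq_sizeP => k jk.
rewrite coefD coefZ mulrBl mul1r coefB coefXM !coef_deriv.
have Pk : (P j)`_k.+1 = 0 by rewrite nth_default // sP ltnS.
rewrite Pk mul0rn sub0r; move: jk; rewrite leq_eqVlt => /predU1P[<-|jk].
  case: j Pk => [|j] _ /=; first by rewrite mul0r oppr0 addr0.
  by rewrite mulr_natl addNr.
case: k jk Pk => // k jk _ /=.
rewrite (nth_default _ (_ : size (P j) <= k.+1)%N) ?sP //.
by rewrite mul0rn oppr0 mulr0 addr0.
Qed.

(** P j is orthogonal to D j, and integration by parts expresses this inner
    product through the squared norm and Ib (P j * P j). *)
Lemma sqnormE j :
  (2 * j%:R + 1 + a + b) * sqnorm j = 2 * b * (P j).[-1] * E j.
Proof.
have := orth_low (size_D j).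
have -> : P j * D j = (1 - 'X) * (P j)^`() * P j + j%:R *: (P j * P j).
  by rewrite /D -!mul_polyC; ring.
have := by_parts (P j) (P j).
have -> : P j * ((1 - 'X) * (P j)^`()) = (1 - 'X) * (P j)^`() * P j by ring.
rewrite ID IZ Ib_mul ?sP // /sqnorm; set Y := I _; set h := I _.
move=> H1 H2; have Yh : Y = - (j%:R * h) by apply/eqP; rewrite -addr_eq0 H2.
by rewrite Yh in H1; lra.
Qed.

(** The integral of the derivative of (P j)^2 vanishes by orthogonality. *)
Lemma endpoint_balance j : a * ((P j).[1] * B j) = b * ((P j).[-1] * E j).
Proof.
have := I_deriv (P j * P j); rewrite Ib_mul ?sP // Ia_mul ?sP //.
have -> : (P j * P j)^`() = P j * (2%:P * (P j)^`()).
  by rewrite derivM polyCMn polyC1; ring.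
rewrite orth_low; first by move=> /esym/eqP; rewrite subr_eq0 => /eqP.
rewrite mul_polyC (leq_trans (size_scale_leq _ _)) //.
by rewrite (leq_trans (size_poly _ _)) // sP.
Qed.

Lemma Ib_endpoint_neq0 j : (P j).[-1] * E j != 0.
Proof.
have h := sqnorm_gt0 j; apply/negP => /eqP H.
have := sqnormE j; rewrite -mulrA H mulr0 => /eqP.
rewrite mulf_eq0 (gt_eqF h) orbF gt_eqF //.
have j0 : 0 <= 2 * j%:R :> R by rewrite mulr_ge0.
by rewrite addr_gt0 // addr_gt0 // ltr_wpDl.
Qed.

Lemma E_neq0 j : E j != 0.
Proof. by have := Ib_endpoint_neq0 j; rewrite mulf_eq0 negb_or => /andP[]. Qed.

Lemma horner1_neq0 j : (P j).[1] != 0.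
Proof.
have := Ib_endpoint_neq0 j; apply: contra => /eqP P1.
have := endpoint_balance j; rewrite P1 mul0r mulr0 => /esym/eqP.
by rewrite mulf_eq0 gt_eqF.
Qed.

Lemma I_D_mul j k : (k < j)%N -> I (D j * P k) = - (2 * b * (P k).[-1] * E j).
Proof.
move=> kj.
have -> : D j * P k = (1 - 'X) * (P j)^`() * P k + j%:R *: (P j * P k).
  by rewrite /D -!mul_polyC; ring.
have jk : I (P j * P k) = 0 by apply: oP => jk; rewrite jk ltnn in kj.
rewrite ID IZ by_parts jk orth_low; last first.
  apply/leq_sizeP => i ji; rewrite mulrBl mul1r coefB coefXM !coef_deriv.
  rewrite [(P k)`_i.+1]nth_default ?sP ?ltnS ?(leq_trans (ltnW kj)) //.
  case: i ji => [|i] ji /=; first by rewrite mul0rn subr0.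
  by rewrite nth_default ?mul0rn ?subr0 // sP (leq_trans kj).
rewrite Ib_mul ?sP; last exact: leqW.
by rewrite /=; ring.
Qed.

(** Kernel polynomials at -1 of consecutive degrees differ by a multiple of P j,
    so D j.+1 / E j.+1 - D j / E j is a multiple of P j, and [sqnormE] gives the
    factor.  The left-hand side has size at most j.+1, so it suffices to check
    its orthogonality to the P k with k <= j. *)
Lemma D_contiguous j :
  E j *: D j.+1 - E j.+1 *: D j
    + ((2 * j%:R + 1 + a + b) * E j.+1) *: P j = 0.
Proof.
apply: (@orth_eq0 j.+1).
  apply: leq_trans (size_polyD _ _) _; rewrite geq_max; apply/andP; split.
    apply: leq_trans (size_polyD _ _) _; rewrite size_polyN geq_max.
    rewrite (leq_trans (size_scale_leq _ _)) ?size_D //=.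
    by rewrite (leq_trans (size_scale_leq _ _)) // leqW // size_D.
  by rewrite (leq_trans (size_scale_leq _ _)) // sP.
move=> k; rewrite ltnS => kj.
rewrite mulrDl mulrBl ID ID IN -!scalerAl !IZ I_D_mul //.
move: kj; rewrite leq_eqVlt => /predU1P[->|kj].
  rewrite [D j * _]mulrC orth_low ?size_D //.
  transitivity (E j.+1 *
    ((2 * j%:R + 1 + a + b) * sqnorm j - 2 * b * (P j).[-1] * E j)).
    by rewrite /sqnorm; ring.
  by rewrite sqnormE subrr mulr0.
have -> : I (P j * P k) = 0 by apply: oP => jk; rewrite jk ltnn in kj.
by rewrite I_D_mul //; ring.
Qed.

(** [D_contiguous] at the point 1, where 1 - X vanishes. *)
Lemma Ib_recurrence j :
  E j * (j.+1%:R * (P j.+1).[1]) = - (E j.+1 * ((j.+1%:R + a + b) * (P j).[1])).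
Proof.
have := congr1 (horner^~ 1) (D_contiguous j).
rewrite /D !(horner1BX, hornerD, hornerN, hornerZ, hornerM, horner0) subrr.
rewrite !mul0r !add0r => H; rewrite -[j.+1]addn1 natrD in H *; lra.
Qed.

Lemma Ia_D j : Ia (D j) = (a + j%:R) * B j - b * E j.
Proof.
rewrite /D IaD IaZ Ia_mul1BX I_deriv.
by rewrite -/(B j) -/(E j); ring.
Qed.

(** [D_contiguous] under the functional Ia, to which the factor 1 - X restores
    the full exponent a. *)
Lemma Ia_recurrence j :
  E j * ((j.+1%:R + a) * B j.+1) = - (E j.+1 * ((j.+1%:R + b) * B j)).
Proof.
have := congr1 Ia (D_contiguous j).
rewrite !(IaD, IaN, IaZ, Ia_D) -/(B j) linear_for0 // => H.
rewrite -[j.+1]addn1 natrD in H *; lra.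
Qed.

(** Given the ratio of the values at 1, [Ib_recurrence] yields the ratio of the
    E j, then [Ia_recurrence] that of the B j, and by [sqnormE] and
    [endpoint_balance] the product of B j by the value at 1 is the squared norm
    up to the factor 2 a / (2 j + 1 + a + b). *)
Lemma sqnorm_recurrence j :
  j.+1%:R * (P j.+1).[1] = (j.+1%:R + a) * (P j).[1] ->
  (j.+1%:R * (j.+1%:R + a + b)) * ((2 * j.+1%:R + 1 + a + b) * sqnorm j.+1)
  = ((j.+1%:R + a) * (j.+1%:R + b)) * ((2 * j%:R + 1 + a + b) * sqnorm j).
Proof.
move=> P1; set n := j.+1%:R in P1 *.
have n0 : 0 < n by rewrite ltr0n.
have S k : (2 * k%:R + 1 + a + b) * sqnorm k = 2 * a * ((P k).[1] * B k).
  by rewrite sqnormE -mulrA -mulrA -endpoint_balance mulrA.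
have E1 : E j * (n + a) = - (E j.+1 * (n + a + b)).
  apply: (mulIf (horner1_neq0 j)).
  by have := Ib_recurrence j; rewrite P1 -/n; lra.
have B1 : (n + a + b) * B j.+1 = (n + b) * B j.
  apply: (mulfI (E_neq0 j.+1)); have := Ia_recurrence j; rewrite -/n.
  by rewrite mulrA E1; lra.
rewrite !S.
have -> : n * (n + a + b) * (2 * a * ((P j.+1).[1] * B j.+1)) =
  2 * a * (n * (P j.+1).[1]) * ((n + a + b) * B j.+1) by ring.
by rewrite P1 B1; ring.
Qed.

End orthogonal_family.

(** * The Jacobi weight and integrals of continuous functions *)

Section pos_power.
Context {R : realType}.
Implicit Types a b t x : R.

(** The power x `^ a equals 1 for x < 0, hence jumps at 0.  The
    truncation makes the powers, and the Jacobi weight below, continuous on the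
    whole line without changing them where they are integrated. *)
Definition pos_powR a x : R := Num.max 0 x `^ a.

Lemma pos_powRE a x : 0 <= x -> pos_powR a x = x `^ a.
Proof. by move=> x0; rewrite /pos_powR max_r. Qed.

Lemma pos_powR_le0 a x : 0 < a -> x <= 0 -> pos_powR a x = 0.
Proof. by move=> a0 x0; rewrite /pos_powR max_l // powR0 // gt_eqF. Qed.

Lemma pos_powR_ge0 a x : 0 <= pos_powR a x.
Proof. exact: powR_ge0. Qed.

Lemma is_derive_pos_powR a x : 0 < x ->
  is_derive x 1 (pos_powR a) (a * pos_powR (a - 1) x).
Proof.
move=> x0; rewrite pos_powRE ?ltW //.
have E : \forall y \near x, y `^ a = pos_powR a y.
  near=> y; rewrite pos_powRE // ltW //; near: y; exact: lt_nbhsr.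
have [d e] := is_derive1_powR a x0.
split; last by rewrite -(near_eq_derive _ E) ?oner_eq0.
by apply: near_eq_derivable E d; rewrite oner_eq0.
Unshelve. all: by end_near.
Qed.

Lemma continuous_pos_powR a : 0 <= a -> continuous (pos_powR a).
Proof.
rewrite le_eqVlt => /predU1P[<-|a0] x.
  by rewrite /continuous_at (_ : pos_powR 0 = cst 1); [exact: cvg_cst|
    apply/funext => y; rewrite /pos_powR powRr0].
have [x0|x0|->] := ltgtP x 0.
- rewrite /continuous_at pos_powR_le0 ?ltW //.
  apply: cvg_near_cst; near=> y; rewrite pos_powR_le0 ?ltW //.
  by near: y; exact: lt_nbhsl.
- have [d _] := is_derive_pos_powR a x0.
  by apply/differentiable_continuous/derivable1_diffP.
- rewrite /continuous_at pos_powR_le0 //; apply/cvgrPdist_lt => e e0.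
  have /cvgrPdist_lt /(_ _ e0) := powR_cvg0 a0.
  move=> /nbhs_ballP[d /= d0 H]; apply/nbhs_ballP; exists d => //= y xy.
  have [y0|y0] := leP y 0; first by rewrite pos_powR_le0 // subrr normr0.
  by rewrite pos_powRE ?ltW //; apply: H.
Unshelve. all: by end_near.
Qed.

Definition cweight a b t := pos_powR a (1 - t) * pos_powR b (1 + t).

Lemma cweightE a b t : t \in `[-1, 1] -> cweight a b t = jacobi_weight a b t.
Proof.
rewrite in_itv /= => /andP[t1 t2].
by rewrite /cweight !pos_powRE ?subr_ge0 // -lerBlDl sub0r.
Qed.

Lemma cweight_ge0 a b t : 0 <= cweight a b t.
Proof. by rewrite mulr_ge0 ?pos_powR_ge0. Qed.

Lemma continuous_cweight a b : 0 <= a -> 0 <= b -> continuous (cweight a b).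
Proof.
move=> a0 b0 t; apply: cvgM.
- apply: (@continuous_comp _ _ _ (fun t : R => 1 - t) (pos_powR a)).
    by apply: cvgB; [exact: cvg_cst|exact: cvg_id].
  exact: continuous_pos_powR.
- apply: (@continuous_comp _ _ _ (fun t : R => 1 + t) (pos_powR b)).
    by apply: cvgD; [exact: cvg_cst|exact: cvg_id].
  exact: continuous_pos_powR.
Qed.

Lemma is_derive_cweight a b t : -1 < t < 1 ->
  is_derive t 1 (cweight a b)
    (b * cweight a (b - 1) t - a * cweight (a - 1) b t).
Proof.
move=> /andP[t1 t2].
have u0 : 0 < 1 - t by rewrite subr_gt0.
have v0 : 0 < 1 + t by lra.
have d1 : is_derive t 1 (fun t : R => 1 - t) (-1).
  by rewrite -[X in is_derive _ _ _ X]sub0r; exact: is_deriveB.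
have d2 : is_derive t 1 (fun t : R => 1 + t) 1.
  by rewrite -[X in is_derive _ _ _ X]add0r; exact: is_deriveD.
have D1 := @is_derive1_comp _ (pos_powR a) (fun t : R => 1 - t) t _ _
  (is_derive_pos_powR a u0) d1.
have D2 := @is_derive1_comp _ (pos_powR b) (fun t : R => 1 + t) t _ _
  (is_derive_pos_powR b v0) d2.
have D := is_deriveM D1 D2.
apply: (is_derive_eq D).
by rewrite /cweight /GRing.scale /=; ring.
Qed.

End pos_power.

Section integrals.
Context {R : realType}.
Notation mu := (@lebesgue_measure R).
Implicit Types (f g : R -> R) (u v : R).

Lemma continuous_integrable f u v : continuous f ->
  mu.-integrable `[u, v] (EFin \o f).
Proof.
move=> cf; apply: continuous_compact_integrable; first exact: segment_compact.
exact: continuous_subspaceT.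
Qed.

Lemma integral_gt0 g u v t0 : continuous g -> (forall t, 0 <= g t) ->
  u < t0 < v -> 0 < g t0 -> 0 < \int[mu]_(t in `[u, v]) g t.
Proof.
move=> cg g0 /andP[ut tv] gt0.
have c0 : 0 < g t0 / 2 by rewrite divr_gt0.
have /cvgrPdist_lt /(_ _ c0) := cg t0.
move=> /nbhs_ballP[d /= d0 H].
pose d' := Num.min (d / 2) (v - t0).
have d'0 : 0 < d' by rewrite lt_min divr_gt0 //= subr_gt0.
have d'd : d' < d by rewrite gt_min; apply/orP; left; lra.
have d'v : t0 + d' <= v by rewrite -lerBrDl ge_min lexx orbT.
have sub : `[t0, t0 + d'] `<=` `[u, v].
  move=> t /=; rewrite !in_itv /= => /andP[]; lra.
have ig := continuous_integrable u v cg.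
apply: (@lt_le_trans _ _ (\int[mu]_(t in `[t0, t0 + d']) (g t0 / 2))).
  rewrite Rintegral_cst //= lebesgue_measure_itv /= lte_fin ltrDl d'0 /=.
  by rewrite mulr_gt0 // addrC addKr.
apply: (@le_trans _ _ (\int[mu]_(t in `[t0, t0 + d']) g t)).
  apply: le_Rintegral => //.
  - by apply: continuous_integrable => ?; exact: cvg_cst.
  - exact: continuous_integrable.
  move=> t; rewrite /= in_itv /= => /andP[t1 t2].
  have /H : ball t0 d t by rewrite /ball /= ltr_norml; apply/andP; split; lra.
  by rewrite ltr_norml => /andP[_]; lra.
rewrite /Rintegral fine_le //.
- by apply: integrable_fin_num => //; exact: continuous_integrable.
- exact: integrable_fin_num.
- apply: ge0_subset_integral => //.
  + exact: (measurable_int mu).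
  + by move=> t _; rewrite lee_fin.
Qed.

Lemma Rintegral_itv_add f u v w : continuous f -> u <= v -> v <= w ->
  \int[mu]_(t in `[u, w]) f t =
  \int[mu]_(t in `[u, v]) f t + \int[mu]_(t in `[v, w]) f t.
Proof.
move=> cf uv vw; apply/eqP; rewrite addrC -subr_eq; apply/eqP.
rewrite Rintegral_itvB ?bnd_simp //; last exact: continuous_integrable.
rewrite Rintegral_itv_obnd_cbnd //.
apply: integrableS (continuous_integrable v w cf) => //.
exact: subset_itv_oc_cc.
Qed.

Lemma Rintegral_sum_cells f (x : nat -> R) n : continuous f ->
  (forall i, (i < n)%N -> x i <= x i.+1) ->
  \sum_(i < n) \int[mu]_(t in `[x i, x i.+1]) f t
  = \int[mu]_(t in `[x 0%N, x n]) f t.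
Proof.
move=> cf; elim: n => [|n IH] xn.
  by rewrite big_ord0 set_itv1 Rintegral_set1.
rewrite big_ord_recr /= IH; last by move=> i ni; rewrite xn // ltnW.
rewrite -Rintegral_itv_add // ?xn //.
have : forall m, (m <= n)%N -> x 0%N <= x m.
  elim=> // m IHm mn; rewrite (le_trans (IHm _)) ?xn //; exact: ltnW.
exact.
Qed.

(** The integral of the square of f minus its mean value is nonnegative. *)
Lemma cauchy_schwarz_mean f u v : continuous f -> u < v ->
  (\int[mu]_(t in `[u, v]) f t) ^+ 2 <=
  (v - u) * \int[mu]_(t in `[u, v]) (f t ^+ 2).
Proof.
move=> cf uv; set J := \int[mu]_(t in _) f t.
have h0 : 0 < v - u by rewrite subr_gt0.
pose m := J / (v - u).
have cf2 : continuous (fun t => f t ^+ 2).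
  move=> t; rewrite /continuous_at; under eq_fun do rewrite expr2.
  by apply: cvgM; exact: cf.
have cmf : continuous (fun t => (2 * m) * f t).
  by move=> t; apply: cvgM; [exact: cvg_cst|exact: cf].
have cc : continuous (fun _ : R => m ^+ 2) by move=> ?; exact: cvg_cst.
have cd : continuous (fun t => f t ^+ 2 - (2 * m) * f t).
  by move=> t; apply: cvgB; [exact: cf2|exact: cmf].
have : 0 <= \int[mu]_(t in `[u, v]) ((f t ^+ 2 - (2 * m) * f t) + m ^+ 2).
  apply: Rintegral_ge0 => t _.
  by rewrite (_ : _ + _ = (f t - m) ^+ 2) ?sqr_ge0 //; ring.
rewrite RintegralD //; [|exact: continuous_integrable..].
rewrite RintegralB //; [|exact: continuous_integrable..].
rewrite RintegralZl //; last exact: continuous_integrable.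
rewrite Rintegral_cst //= lebesgue_measure_itv /= lte_fin uv /= -/J.
move=> H; rewrite -ler_pdivrMl // -subr_ge0; apply: le_trans H _.
rewrite le_eqVlt; apply/orP; left; apply/eqP; rewrite /m.
by field; rewrite gt_eqF.
Qed.

End integrals.

(** * Integration of polynomials against the Jacobi weight *)

Section jacobi_functional.
Context {R : realType}.
Notation mu := (@lebesgue_measure R).
Implicit Types (a b c : R) (p q : {poly R}).

(** The continuous form of the weight is used so that continuity, and with it
    integrability, holds without reference to the interval. *)
Definition jint a b p := \int[mu]_(t in `[-1, 1]) (p.[t] * cweight a b t).

Lemma jintE a b p :
  \int[mu]_(t in `[-1, 1]) (p.[t] * jacobi_weight a b t) = jint a b p.
Proof. by apply: eq_Rintegral => t; rewrite inE => /cweightE ->. Qed.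

Lemma continuous_jint a b p : 0 <= a -> 0 <= b ->
  continuous (fun t => p.[t] * cweight a b t).
Proof.
move=> a0 b0 t; apply: cvgM; first exact: continuous_horner.
exact: continuous_cweight.
Qed.

Lemma jint_linear a b : 0 <= a -> 0 <= b -> linear_for *%R (jint a b).
Proof.
move=> a0 b0 c p q; rewrite /jint.
rewrite -RintegralZl //; last first.
  by apply: continuous_integrable; exact: continuous_jint.
rewrite -RintegralD //; last 2 first.
- apply: continuous_integrable => t; apply: cvgM; first exact: cvg_cst.
  exact: continuous_jint.
- by apply: continuous_integrable; exact: continuous_jint.
by apply: eq_Rintegral => t _; rewrite hornerD hornerZ mulrDl -mulrA.
Qed.

Lemma jint_mul1BX a b p : 0 < a -> jint (a - 1) b ((1 - 'X) * p) = jint a b p.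
Proof.
move=> a0; apply: eq_Rintegral => t; rewrite inE /= in_itv /= => /andP[t1' t1].
have u0 : 0 <= 1 - t by rewrite subr_ge0.
rewrite /cweight !(pos_powRE _ u0) -(mulr_powRB1 u0 a0) hornerM horner1BX; ring.
Qed.

Lemma jint_mul1DX a b p : 0 < b -> jint a (b - 1) ((1 + 'X) * p) = jint a b p.
Proof.
move=> b0; apply: eq_Rintegral => t; rewrite inE /= in_itv /= => /andP[t1 t1'].
have u0 : 0 <= 1 + t by rewrite -lerBlDl sub0r.
rewrite /cweight !(pos_powRE _ u0) -(mulr_powRB1 u0 b0) hornerM horner1DX; ring.
Qed.

Lemma jint_gt0 a b p : 0 <= a -> 0 <= b -> p != 0 -> 0 < jint a b (p * p).
Proof.
move=> a0 b0 p0.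
have [t0 t01 pt0] : exists2 t, -1 < t < 1 & p.[t] != 0.
  (* More points of the open interval than p can have roots. *)
  pose s := [seq (k.+2%:R : R)^-1 | k <- iota 0 (size p)].
  have us : uniq s.
    rewrite map_inj_uniq ?iota_uniq // => i j /invr_inj/eqP.
    by rewrite eqr_nat => /eqP[].
  have := max_poly_roots p0 _ us; rewrite size_map size_iota ltnn => H.
  have /allPn[t /mapP[k _ ->] rk] : ~~ all (root p) s by apply/negP => /H.
  exists k.+2%:R^-1; last exact: rk.
  rewrite invf_lt1 ?ltr1n // andbT (lt_trans (ltrN10 _)) //.
apply: (integral_gt0 (t0 := t0)) => //.
- exact: continuous_jint.
- by move=> t; rewrite hornerM -expr2 mulr_ge0 ?sqr_ge0 ?cweight_ge0.
- move: t01 => /andP[t1 t2].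
  rewrite hornerM -expr2 mulr_gt0 ?exprn_even_gt0 //= /cweight.
  rewrite !pos_powRE; try lra.
  by rewrite mulr_gt0 // powR_gt0; lra.
Qed.

(** The boundary terms vanish because both exponents are positive, and the
    exponents are at least 1 for the derivative of the weight to be continuous
    up to the endpoints. *)
Lemma jint_deriv a b p : 1 <= a -> 1 <= b ->
  jint a b p^`() = a * jint (a - 1) b p - b * jint a (b - 1) p.
Proof.
move=> a1 b1.
have a0 : 0 <= a by exact: le_trans a1.
have b0 : 0 <= b by exact: le_trans b1.
have a10 : 0 <= a - 1 by rewrite subr_ge0.
have b10 : 0 <= b - 1 by rewrite subr_ge0.
pose F t := p.[t] * cweight a b t.
pose f1 t := p^`().[t] * cweight a b t.
pose f2 t := b * (p.[t] * cweight a (b - 1) t).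
pose f3 t := a * (p.[t] * cweight (a - 1) b t).
have c1 : continuous f1 by exact: continuous_jint.
have c2 : continuous f2.
  by move=> t; apply: cvgM; [exact: cvg_cst|exact: continuous_jint].
have c3 : continuous f3.
  by move=> t; apply: cvgM; [exact: cvg_cst|exact: continuous_jint].
have c12 : continuous (fun t => f1 t + f2 t).
  by move=> t; apply: cvgD; [exact: c1|exact: c2].
have c123 : continuous (fun t => (f1 t + f2 t) - f3 t).
  by move=> t; apply: cvgB; [exact: c12|exact: c3].
have cF : continuous F by exact: continuous_jint.
have dF (t : R) : -1 < t < 1 -> is_derive t (1 : R) F (f1 t + f2 t - f3 t).
  move=> t1.
  have D := is_deriveM (is_derive_poly p t) (is_derive_cweight a b t1).
  by apply: (is_derive_eq D); rewrite /f1 /f2 /f3 /GRing.scale /=; ring.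
have F1 : F 1 = 0.
  by rewrite /F /cweight subrr pos_powR_le0 ?mul0r ?mulr0 // (lt_le_trans _ a1).
have FN1 : F (-1) = 0.
  by rewrite /F /cweight subrr (@pos_powR_le0 _ b) ?mulr0 // (lt_le_trans _ b1).
have N11 : (-1 : R) < 1 by lra.
have := @continuous_FTC2 R (fun t => (f1 t + f2 t) - f3 t) F (-1) 1 N11.
rewrite F1 FN1 -EFinB subrr => H.
have {}H : \int[mu]_(t in `[-1, 1]) (f1 t + f2 t - f3 t) = 0.
  rewrite /Rintegral H //.
  - exact: continuous_subspaceT.
  - split.
    + by move=> t; rewrite in_itv /= => /dF[].
    + by apply: cvg_at_right_filter; exact: cF.
    + by apply: cvg_at_left_filter; exact: cF.
  - by move=> t; rewrite in_itv /= derive1E => /dF[_ ->].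
move: H.
rewrite RintegralB //; [|exact: continuous_integrable..].
rewrite RintegralD //; [|exact: continuous_integrable..].
rewrite !RintegralZl //;
  [|by apply: continuous_integrable; exact: continuous_jint..].
rewrite -/(jint a b _) -/(jint _ _ p) -/(jint _ _ p).
by move: (jint _ _ _) (jint _ _ _) (jint _ _ _) => x y z; lra.
Qed.

End jacobi_functional.

(** * The functional equation of Gamma *)

Section gamma_function.
Context {R : realType}.
Notation mu := (@lebesgue_measure R).
Implicit Types (p s t : R).

Lemma GammaE s : 1 <= s -> Gamma s =
  \int[mu]_(t in `[0, +oo[) (pos_powR (s - 1) t * expR (- t)).
Proof.
move=> s1; have p0 : 0 <= s - 1 by rewrite subr_ge0.
rewrite /Gamma /Rintegral -[in RHS]integral_itv_obnd_cbnd; last first.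
  apply/measurable_EFinP; apply: measurable_funTS.
  apply: continuous_measurable_fun => t; apply: cvgM.
    exact: continuous_pos_powR.
  apply: (@continuous_comp _ _ _ (@GRing.opp R) (@expR R)).
    exact: opp_continuous.
  exact: continuous_expR.
apply: congr1; apply: eq_integral => t; rewrite inE /= in_itv /= andbT => t0.
by rewrite pos_powRE // ltW.
Qed.

(** Raise x <= exp x to the power p at x = t / (2 (p + 1)). *)
Lemma powR_le_expR p t : 0 <= p -> 0 <= t ->
  t `^ p <= (2 * (p + 1)) `^ p * expR (t / 2).
Proof.
move=> p0 t0; pose k := 2 * (p + 1).
have k0 : 0 < k by rewrite mulr_gt0 // ltr_wpDl.
have tk : t / k <= expR (t / k).
  by apply: le_trans (expR_ge1Dx _); rewrite lerDr.
have {1}-> : t = k * (t / k) by rewrite mulrC divfK // gt_eqF.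
have tk0 : 0 <= t / k by rewrite divr_ge0 // ltW.
rewrite (powRM _ (ltW k0) tk0) -/k ler_wpM2l ?powR_ge0 //.
apply: (le_trans (ge0_ler_powR p0 _ _ tk)); rewrite ?nnegrE ?expR_ge0 //.
rewrite -expRM ler_expR -mulrA ler_wpM2l // mulrC ler_pdivrMr // /k; lra.
Qed.

Let halfexp t := expR (- (t / 2)).

Let is_derive_halfexp (t : R) : is_derive t (1 : R) halfexp (- (halfexp t / 2)).
Proof.
have d : is_derive t (1 : R) (fun t : R => - (t / 2)) (- 2^-1).
  have -> : (fun t : R => - (t / 2)) = - (2^-1 \*: id).
    by apply/funext => y; rewrite /= fctE mulrC.
  have D := is_deriveN (is_deriveZ 2^-1 (is_derive_id t (1 : R))).
  by apply: (is_derive_eq D); rewrite /GRing.scale /= mulr1.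
have D := @is_derive1_comp _ expR (fun t : R => - (t / 2)) t _ _
  (is_derive_expR (- (t / 2))) d.
by apply: (is_derive_eq D); rewrite /halfexp; lra.
Qed.

Let continuous_halfexp : continuous halfexp.
Proof.
move=> t; have [d _] := is_derive_halfexp t.
exact/differentiable_continuous/derivable1_diffP.
Qed.

Let cvg_halfexp : halfexp t @[t --> +oo] --> 0.
Proof.
apply: (@cvg_comp _ _ _ (fun t : R => t / 2) (fun t => expR (- t)) _
  (pinfty_nbhs R)).
  by apply: gt0_cvgMly; [rewrite invr_gt0|exact: cvg_id].
exact: cvgr_expR.
Qed.

(** The derivative of - t^s exp(-t) is the difference of the two integrands.
    Adding C exp(-t/2), with C large enough to make this difference nonnegative,
    allows the fundamental theorem of calculus on the half-line, and the
    identity follows between integrals of nonnegative functions, whether or not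
    they are finite. *)
Lemma GammaS s : 1 <= s -> Gamma (s + 1) = s * Gamma s.
Proof.
move=> s1; have s0 : 0 < s by exact: lt_le_trans s1.
have p0 : 0 <= s - 1 by rewrite subr_ge0.
rewrite !GammaE //; last by rewrite lerDr ltW.
rewrite addrK.
have expN t : expR (- t) = halfexp t * halfexp t.
  by rewrite /halfexp -expRD; congr expR; lra.
pose C := s * (2 * (s - 1 + 1)) `^ (s - 1).
have C0 : 0 <= C by rewrite mulr_ge0 ?powR_ge0 // ltW.
pose f1 t := pos_powR s t * expR (- t).
pose f2 t := pos_powR (s - 1) t * expR (- t).
pose g t := f1 t - s * f2 t + C * halfexp t.
pose F t := - f1 t - 2 * C * halfexp t.
have cN : continuous (fun t : R => expR (- t)).
  move=> t; apply: (@continuous_comp _ _ _ (@GRing.opp R) (@expR R)).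
    exact: opp_continuous.
  exact: continuous_expR.
have cf1 : continuous f1.
  move=> t; apply: cvgM; last exact: cN.
  by apply: continuous_pos_powR; exact: ltW.
have cf2 : continuous f2.
  by move=> t; apply: cvgM; [exact: continuous_pos_powR|exact: cN].
have ch : continuous (fun t => C * halfexp t).
  by move=> t; apply: cvgM; [exact: cvg_cst|exact: continuous_halfexp].
have cg : continuous g.
  move=> t; apply: cvgD; last exact: ch.
  apply: cvgB; [exact: cf1|apply: cvgM; [exact: cvg_cst|exact: cf2]].
have cF : continuous F.
  move=> t; apply: cvgB; first by apply: cvgN; exact: cf1.
  by apply: cvgM; [exact: cvg_cst|exact: continuous_halfexp].
have dF t : 0 < t -> is_derive t (1 : R) F (g t).
  move=> t0.
  have dN : is_derive t (1 : R) (fun t : R => expR (- t)) (- expR (- t)).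
    have D := @is_derive1_comp _ expR (fun t : R => - t) t _ _
      (is_derive_expR (- t)) (is_deriveNid t (1 : R)).
    by apply: (is_derive_eq D); rewrite mulrN1.
  have D := is_deriveB (is_deriveN (is_deriveM (is_derive_pos_powR s t0) dN))
    (is_deriveZ (2 * C) (is_derive_halfexp t)).
  apply: (is_derive_eq D).
  by rewrite /g /f1 /f2 /GRing.scale /=; field.
have half_ge0 t : 0 <= halfexp t by exact: expR_ge0.
have g0 t : 0 <= t -> 0 <= g t.
  move=> t0; rewrite /g /f2 expN pos_powRE //.
  have := powR_le_expR p0 t0; rewrite -(ler_pM2l s0) => H.
  have : s * (t `^ (s - 1) * (halfexp t * halfexp t)) <= C * halfexp t.
    rewrite !mulrA ler_wpM2r //.
    have -> : C = C * expR (t / 2) * halfexp t.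
      by rewrite /halfexp -mulrA -expRD subrr expR0 mulr1.
    by rewrite ler_wpM2r // /C -mulrA.
  have : 0 <= f1 t by rewrite mulr_ge0 ?pos_powR_ge0 ?expR_ge0.
  lra.
have f1y : f1 t @[t --> +oo] --> 0.
  pose K := (2 * (s + 1)) `^ s.
  have Ky : K * halfexp t @[t --> +oo] --> 0.
    rewrite -[X in _ --> X](mulr0 K).
    by apply: cvgM; [exact: cvg_cst|exact: cvg_halfexp].
  apply: (@squeeze_cvgr _ _ _ _ (fun=> 0) (fun t => K * halfexp t));
    last 2 first.
  - exact: cvg_cst.
  - exact: Ky.
  near=> t.
  have t0 : 0 <= t by near: t; exact: nbhs_pinfty_ge.
  rewrite mulr_ge0 ?pos_powR_ge0 ?expR_ge0 //= /f1 pos_powRE // expN mulrA.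
  rewrite ler_wpM2r //.
  have -> : K = K * expR (t / 2) * halfexp t.
    by rewrite /halfexp -mulrA -expRD subrr expR0 mulr1.
  by rewrite ler_wpM2r // powR_le_expR // ltW.
have intg : (\int[mu]_(t in `[0%R, +oo[) (g t)%:E = (2 * C)%:E)%E.
  rewrite (@ge0_continuous_FTC2y R g F 0 0) //.
  - rewrite /F /f1 pos_powR_le0 // mul0r /halfexp mul0r oppr0 expR0 -EFinB.
    by congr EFin; ring.
  - exact: continuous_subspaceT.
  - rewrite -[X in _ --> X](_ : - 0 - 2 * C * 0 = 0); last ring.
    apply: cvgB; first exact: cvgN.
    by apply: cvgM; [exact: cvg_cst|exact: cvg_halfexp].
  - by move=> t /dF[].
  - by apply: cvg_at_right_filter; exact: cF.
  - by move=> t; rewrite in_itv /= andbT derive1E => /dF[_ ->].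
have inth : (\int[mu]_(t in `[0%R, +oo[) (C * halfexp t)%:E = (2 * C)%:E)%E.
  rewrite (@ge0_continuous_FTC2y R (fun t => C * halfexp t)
    (fun t => - (2 * C) * halfexp t) 0 0) //.
  - by rewrite /halfexp mul0r oppr0 expR0 -EFinB; congr EFin; ring.
  - by move=> t _; rewrite mulr_ge0.
  - exact: continuous_subspaceT.
  - rewrite -[X in _ --> X](_ : - (2 * C) * 0 = 0); last ring.
    by apply: cvgM; [exact: cvg_cst|exact: cvg_halfexp].
  - apply: cvg_at_right_filter; apply: cvgM; first exact: cvg_cst.
    exact: continuous_halfexp.
  - move=> t _; rewrite derive1E.
    have [_ ->] := is_deriveZ (- (2 * C)) (is_derive_halfexp t).
    by rewrite /GRing.scale /=; field.
have m (f : R -> R) : continuous f ->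
    measurable_fun (`[0%R, +oo[%classic : set (measurableTypeR R)) (EFin \o f).
  move=> cf; apply/measurable_EFinP; apply: measurable_funTS.
  exact: continuous_measurable_fun.
have f1_ge0 t : 0 <= f1 t by rewrite mulr_ge0 ?pos_powR_ge0 ?expR_ge0.
have f2_ge0 t : 0 <= f2 t by rewrite mulr_ge0 ?pos_powR_ge0 ?expR_ge0.
have csf2 : continuous (fun t => s * f2 t).
  by move=> t; apply: cvgM; [exact: cvg_cst|exact: cf2].
have E1 : (\int[mu]_(t in `[0%R, +oo[) ((g t)%:E + (s * f2 t)%:E) =
    \int[mu]_(t in `[0%R, +oo[) ((f1 t)%:E + (C * halfexp t)%:E))%E.
  apply: eq_integral => t _; rewrite -!EFinD; congr EFin; rewrite /g; ring.
move: E1.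
rewrite ge0_integralD //; last 4 first.
- by move=> t; rewrite /= in_itv /= andbT lee_fin => /g0.
- exact: m.
- by move=> t _; rewrite lee_fin mulr_ge0 // ltW.
- exact: m.
rewrite ge0_integralD //; last 4 first.
- by move=> t _; rewrite lee_fin.
- exact: m.
- by move=> t _; rewrite lee_fin mulr_ge0.
- exact: m.
rewrite intg inth.
under eq_integral do rewrite EFinM.
rewrite ge0_integralZl_EFin //; last 3 first.
- by move=> t _; rewrite lee_fin.
- exact: m.
- exact: ltW.
rewrite addeC => H.
have {}H := congr1 (fun x => x - (2 * C)%:E)%E H.
move: H; rewrite !addeK // => H.
rewrite /Rintegral -H.
by case: (\int[mu]_(x in _) _)%E => [x| |] //=;
  rewrite mulr_infty gtr0_sg // mul1e mulr0.
Unshelve. all: by end_near.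
Qed.

End gamma_function.

(** * Norms of Jacobi polynomials *)

Lemma jacobi_at1S (R : realType) (a b : R) (P : nat -> {poly R}) j :
  1 < a -> jacobi_polynomials a b P ->
  j.+1%:R * (P j.+1).[1] = (j.+1%:R + a) * (P j).[1].
Proof.
move=> a1 [_ _ P1]; rewrite !P1.
have n1 : 1 <= j.+1%:R :> R by rewrite ler1n.
have -> : Gamma (j.+1%:R + a + 1) = (j.+1%:R + a) * Gamma (j%:R + a + 1).
  rewrite GammaS; last by rewrite (le_trans n1) // lerDl (le_trans _ (ltW a1)).
  by congr (_ * Gamma _); rewrite -addn1 natrD; ring.
have -> : Gamma (j.+1%:R + 1 : R) = j.+1%:R * Gamma (j%:R + 1).
  by rewrite GammaS //; congr (_ * Gamma _); rewrite natr1.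
rewrite !invfM.
have nV : j.+1%:R * j.+1%:R^-1 = 1 :> R by rewrite divff // pnatr_eq0.
set n := j.+1%:R in nV *; set G1 := Gamma _; set G2 := (Gamma _)^-1.
set G3 := (Gamma _)^-1.
transitivity ((n * n^-1) * ((n + a) * (G1 * (G2 * G3)))); first ring.
by rewrite nV mul1r.
Qed.

(** The growth factor at step n is at most exp(a b (1/n - 1/(n+1))), which
    telescopes. *)
Lemma sqnorm_bound (R : realType) (a b : R) (P : nat -> {poly R}) :
  1 < a -> 1 < b -> jacobi_polynomials a b P ->
  exists2 C, 0 < C & forall j, sqnorm (jint a b) P j <= C / j.+1%:R.
Proof.
move=> a1 b1 hP; have [sP oP0 _] := hP.
have a0 : 0 < a := lt_trans ltr01 a1; have b0 : 0 < b := lt_trans ltr01 b1.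
have oP j k : j <> k -> jint a b (P j * P k) = 0.
  move=> /oP0; rewrite -jintE; under eq_Rintegral do rewrite -hornerM.
  exact.
have jgt0 p : p != 0 -> 0 < jint a b (p * p).
  by apply: jint_gt0; exact: ltW.
have h0 j : 0 < sqnorm (jint a b) P j by exact: sqnorm_gt0.
have am : 0 <= a - 1 by rewrite subr_ge0 ltW.
have bm : 0 <= b - 1 by rewrite subr_ge0 ltW.
pose S j := (2 * j%:R + 1 + a + b) * sqnorm (jint a b) P j.
have S0 : 0 < S 0%N by rewrite mulr_gt0 // mulr0 add0r !addr_gt0.
have SS j : S j.+1 <= S j * expR (a * b * (j.+1%:R^-1 - j.+2%:R^-1)).
  have := sqnorm_recurrence a0 b0 (jint_linear (ltW a0) (ltW b0))
    (jint_linear am (ltW b0)) (jint_linear (ltW a0) bm)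
    (fun p => jint_mul1BX b p a0) (fun p => jint_mul1DX a p b0)
    (fun p => jint_deriv p (ltW a1) (ltW b1)) jgt0 sP oP
    (jacobi_at1S j a1 hP).
  rewrite -/(S j) -/(S j.+1) => H.
  have -> : j.+2%:R = j.+1%:R + 1 :> R by rewrite natr1.
  have n0 : 0 < j.+1%:R :> R by rewrite ltr0n.
  set n := j.+1%:R in H n0 *; clearbody n.
  have nab : 0 < n * (n + a + b) by rewrite mulr_gt0 // !addr_gt0.
  have -> : S j.+1 = S j * (1 + a * b / (n * (n + a + b))).
    have nab1 : n + a + b != 0 by rewrite gt_eqF // !addr_gt0.
    apply: (mulfI (lt0r_neq0 nab)); rewrite H; field.
    by rewrite nab1 gt_eqF.
  rewrite ler_wpM2l //.
    by rewrite mulr_ge0 ?(ltW (h0 _)) // !addr_ge0 ?mulr_ge0 // ltW.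
  apply: le_trans (expR_ge1Dx _) _; rewrite ler_expR.
  have -> : n^-1 - (n + 1)^-1 = (n * (n + 1))^-1.
    by field; rewrite !gt_eqF // addr_gt0.
  rewrite ler_pM2l ?mulr_gt0 // lef_pV2 ?posrE ?mulr_gt0 // ?addr_gt0 //.
  rewrite ler_pM2l //; lra.
have SE j : S j <= S 0%N * expR (a * b * (1 - j.+1%:R^-1)).
  elim: j => [|j IH]; first by rewrite invr1 subrr mulr0 expR0 mulr1.
  apply: le_trans (SS j) _.
  apply: le_trans (ler_wpM2r (expR_ge0 _) IH) _.
  rewrite -[leLHS]mulrA -expRD.
  by rewrite (_ : _ + _ = a * b * (1 - j.+2%:R^-1)) //; ring.
exists (S 0%N * expR (a * b)); first by rewrite mulr_gt0 ?expR_gt0.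
move=> j; have n0 : 0 < j.+1%:R :> R by rewrite ltr0n.
rewrite ler_pdivlMr //; apply: (@le_trans _ _ (S j)).
  rewrite mulrC ler_wpM2r ?(ltW (h0 _)) // -natr1.
  have := ler0n R j; lra.
apply: le_trans (SE j) _; rewrite ler_wpM2l ?(ltW S0) // ler_expR.
by rewrite ler_piMr ?mulr_ge0 ?ltW // ltrBlDr ltrDl invr_gt0.
Qed.

(** * The histopolation matrix away from a frame *)

Section histopolation.
Context {R : realType}.
Notation mu := (@lebesgue_measure R).

(** The quotient of the two sides without the constant is
    (1 - t)^(al - 1) (1 + t)^(be - 1), and each base lies in [d, 2]. *)
Lemma cweight_sqr_le (al be d t : R) : 0 < al -> 0 < be -> 0 < d ->
  -1 + d <= t <= 1 - d ->
  cweight al be t ^+ 2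
  <= (2 `^ al * 2 `^ be / d ^+ 2) * cweight (al + 1) (be + 1) t.
Proof.
move=> al0 be0 d0 /andP[t1 t2].
have side (p u : R) : 0 < p -> d <= u <= 2 ->
    pos_powR p u ^+ 2 <= (2 `^ p / d) * pos_powR (p + 1) u.
  move=> p0 /andP[du u2]; have u0 : 0 <= u by rewrite (le_trans _ du) // ltW.
  rewrite !pos_powRE // -(@mulr_powRB1 _ u (p + 1)) ?addr_gt0 //.
  rewrite addrK expr2 mulrA ler_wpM2r ?powR_ge0 //.
  rewrite -[leLHS]mulr1 -mulrA ler_pM ?powR_ge0 //.
    by rewrite ge0_ler_powR ?nnegrE // ltW.
  by rewrite mulrC ler_pdivlMr // mul1r.
have dd : 0 < d ^+ 2 by rewrite exprn_gt0.
rewrite /cweight exprMn.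
have -> : 2 `^ al * 2 `^ be / d ^+ 2 *
    (pos_powR (al + 1) (1 - t) * pos_powR (be + 1) (1 + t)) =
  (2 `^ al / d * pos_powR (al + 1) (1 - t)) *
  (2 `^ be / d * pos_powR (be + 1) (1 + t)).
  by field; rewrite gt_eqF.
rewrite ler_pM ?sqr_ge0 ?side //; lra.
Qed.

Lemma mesh_lower N (x : nat -> R) c k : mesh N x -> 0 < c ->
  (forall i, (i < N)%N -> c / N%:R <= x i.+1 - x i) -> (k <= N)%N ->
  -1 + c * k%:R / N%:R <= x k /\ x (N - k)%N <= 1 - c * k%:R / N%:R.
Proof.
move=> [x0 xN _] c0 hx; elim: k => [|k IH] kN.
  by rewrite mulr0 mul0r addr0 subr0 subn0 x0 xN.
have [IH1 IH2] := IH (ltnW kN).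
have -> : c * k.+1%:R / N%:R = c * k%:R / N%:R + c / N%:R.
  by rewrite -natr1 mulrDr mulr1 mulrDl.
have h1 := hx _ kN.
have := hx (N - k.+1)%N; rewrite ltn_subrL (leq_ltn_trans _ kN) //= => /(_ isT).
rewrite -subSn // subSS => h2; split; lra.
Qed.

Lemma mesh_homo N (x : nat -> R) i j : mesh N x -> (i <= j)%N -> (j <= N)%N ->
  x i <= x j.
Proof.
move=> [_ _ hx]; elim: j => [|j IH]; first by rewrite leqn0 => /eqP ->.
rewrite leq_eqVlt ltnS => /predU1P[->//|ij] jN.
by rewrite (le_trans (IH ij (ltnW jN))) // ltW // hx.
Qed.

Lemma sum_kept_sqr (al be c d : R) (P : nat -> {poly R}) N (x : nat -> R)
    (j : 'I_N) (kept : {pred 'I_N}) :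
  0 < al -> 0 < be -> 0 < c -> 0 < d -> mesh N x ->
  (forall i, (i < N)%N -> c / N%:R <= x i.+1 - x i) ->
  (forall i, i \in kept -> -1 + d <= x i /\ x i.+1 <= 1 - d) ->
  \sum_(i in kept) histopolation_mx al be P N x i j ^+ 2 <=
  N%:R / c * (2 `^ al * 2 `^ be / d ^+ 2) * sqnorm (jint (al + 1) (be + 1)) P j.
Proof.
move=> al0 be0 c0 d0 hm hx hk; have [x0 xN xlt] := hm.
set K := _ / d ^+ 2.
have K0 : 0 <= K by rewrite !mulr_ge0 ?powR_ge0 // invr_ge0 exprn_ge0 // ltW.
pose g t := (P j * P j).[t] * cweight (al + 1) (be + 1) t.
have al1 : 0 <= al + 1 by rewrite addr_ge0 // ltW.
have be1 : 0 <= be + 1 by rewrite addr_ge0 // ltW.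
have cg : continuous g by exact: continuous_jint.
have g0 t : 0 <= g t.
  by rewrite mulr_ge0 ?cweight_ge0 // hornerM -expr2 sqr_ge0.
have cellg0 (i : 'I_N) : 0 <= \int[mu]_(t in `[x i, x i.+1]) g t.
  by apply: Rintegral_ge0.
have N0 : 0 < N%:R :> R by rewrite ltr0n (leq_trans _ (ltn_ord j)).
have -> : sqnorm (jint (al + 1) (be + 1)) P j =
    \sum_(i < N) \int[mu]_(t in `[x i, x i.+1]) g t.
  rewrite (Rintegral_sum_cells cg) ?x0 ?xN // => i iN.
  by rewrite ltW // xlt.
rewrite mulr_sumr [leLHS]big_mkcond /=; apply: ler_sum => i _.
case: ifP => ik; last first.
  by rewrite mulr_ge0 ?cellg0 // mulr_ge0 // divr_ge0 // ltW.
have [xi1 xi2] := hk i ik.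
have h0 : 0 < x i.+1 - x i by rewrite subr_gt0 xlt.
rewrite mxE.
pose f t := (P j).[t] * cweight al be t.
have cf : continuous f by apply: continuous_jint; exact: ltW.
have cf2 : continuous (fun t => f t ^+ 2).
  move=> t; rewrite /continuous_at; under eq_fun do rewrite expr2.
  by apply: cvgM; exact: cf.
have cKg : continuous (fun t => K * g t).
  by move=> t; apply: cvgM; [exact: cvg_cst|exact: cg].
have -> : \int[mu]_(t in `[x i, x i.+1]) ((P j).[t] * jacobi_weight al be t)
    = \int[mu]_(t in `[x i, x i.+1]) f t.
  apply: eq_Rintegral => t; rewrite inE /= in_itv /= => /andP[t1 t2].
  by rewrite /f cweightE // in_itv /=; apply/andP; split; lra.
rewrite exprMn exprVn.
have CS := cauchy_schwarz_mean cf (xlt _ (ltn_ord i)).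
have fg : \int[mu]_(t in `[x i, x i.+1]) (f t ^+ 2) <=
    K * \int[mu]_(t in `[x i, x i.+1]) g t.
  rewrite -RintegralZl //; last exact: continuous_integrable.
  apply: le_Rintegral => //; [exact: continuous_integrable..|].
  move=> t; rewrite /= in_itv /= => /andP[t1 t2].
  rewrite /f /g exprMn hornerM -expr2 [leRHS]mulrCA ler_wpM2l ?sqr_ge0 //.
  by apply: cweight_sqr_le => //; apply/andP; split; lra.
rewrite ler_pdivrMl ?exprn_gt0 //.
apply: le_trans CS _; rewrite expr2 -[leRHS]mulrA ler_pM2l //.
apply: le_trans fg _.
have -> : N%:R / c * K * \int[mu]_(t in `[x i, x i.+1]) g t =
  (c / N%:R)^-1 * (K * \int[mu]_(t in `[x i, x i.+1]) g t).
  by rewrite invf_div mulrA.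
rewrite [leRHS]mulrA ler_peMl ?(mulr_ge0 K0 (cellg0 i)) //.
by rewrite ler_pdivlMr ?divr_gt0 // mul1r hx.
Qed.

End histopolation.

Lemma card_ord_interval N m k : (#|[pred i : 'I_N | m <= i < m + k]| <= k)%N.
Proof.
rewrite -{2}(size_iota m k) cardE -(size_map val).
apply: uniq_leq_size.
  by rewrite map_inj_uniq ?enum_uniq //; exact: val_inj.
by move=> _ /mapP[i + ->]; rewrite mem_enum inE mem_iota.
Qed.

(** A matrix supported on the first k columns and the first and last k rows is
    the sum of one with at most 2 k nonzero rows and one with at most k nonzero
    columns. *)
Lemma mxrank_frame (F : fieldType) N k (B : 'M[F]_N) :
  (forall i j : 'I_N, (k <= i < N - k)%N -> (k <= j)%N -> B i j = 0) ->
  (\rank B <= 3 * k)%N.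
Proof.
move=> B0.
pose top := [pred i : 'I_N | (0 <= i < 0 + k)%N].
pose bot := [pred i : 'I_N | (N - k <= i < N - k + k)%N].
pose rows := [predU top & bot].
pose B1 := \matrix_(i, j) if i \in rows then B i j else 0.
pose B2 := \matrix_(i, j) if i \in rows then 0 else B i j.
have -> : B = B1 + B2.
  by apply/matrixP => i j; rewrite !mxE; case: ifP; rewrite ?addr0 ?add0r.
apply: leq_trans (mxrank_add _ _) _.
have -> : (3 * k = k + k + k)%N by rewrite !mulSn mul0n addn0 addnA.
apply: leq_add.
  apply: (@leq_trans #|rows|).
    by apply: mxrank_zero_rows => i j /negbTE ir; rewrite mxE ir.
  rewrite -(leq_add2r #|[predI top & bot]|) cardUI.
  apply: leq_trans (leq_addr _ _).
  by apply: leq_add; exact: card_ord_interval.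
rewrite -mxrank_tr; apply: leq_trans (card_ord_interval N 0 k).
apply: mxrank_zero_rows => j i; rewrite inE /= add0n -leqNgt => kj.
rewrite !mxE; case: ifP => // /negbT; rewrite !inE negb_or /= add0n -leqNgt.
move=> /andP[ki]; rewrite negb_and -ltnNge => /orP[iN|]; first exact/B0/kj/andP.
rewrite -leqNgt => Nk; have := ltn_ord i; rewrite ltnNge.
by rewrite (leq_trans _ Nk) // addnC -leq_subLR leqnn.
Qed.

(** Each kept column has degree j >= N / q, hence squared norm at most C q / N,
    which compensates the factor N / c from the mesh width; the N columns then
    give a bound linear in N. *)
Lemma kept_block_frobenius (R : realType) (al be c C l : R)
    (P : nat -> {poly R}) N (x : nat -> R) q k :
  0 < al -> 0 < be -> 0 < c -> 0 < C -> 0 < l -> (0 < q)%N -> (0 < N)%N ->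
  mesh N x -> (forall i, (i < N)%N -> c / N%:R <= x i.+1 - x i) ->
  (forall j, sqnorm (jint (al + 1) (be + 1)) P j <= C / j.+1%:R) ->
  k = (N %/ q).+1 ->
  \sum_(i < N | (k <= i < N - k)%N) \sum_(j < N | (k <= j)%N)
    (l^-1 * histopolation_mx al be P N x i j) ^+ 2 <=
  (C / c * (2 `^ al * 2 `^ be / (c / q%:R) ^+ 2) * q%:R) / l ^+ 2 * N%:R.
Proof.
move=> al0 be0 c0 C0 l0 q0 N0 hm hx hC kE.
have q0R : 0 < q%:R :> R by rewrite ltr0n.
have N0R : 0 < N%:R :> R by rewrite ltr0n.
set K := _ / (c / q%:R) ^+ 2.
have K0 : 0 <= K by rewrite mulr_ge0 ?mulr_ge0 ?powR_ge0 // invr_ge0 sqr_ge0.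
have Nk : N%:R / q%:R <= k%:R :> R.
  by rewrite ler_pdivrMr // -natrM ler_nat kE ltnW // -ltn_divLR.
have d0 : 0 < c / q%:R by rewrite divr_gt0.
have kd : c / q%:R <= c * k%:R / N%:R.
  by rewrite -mulrA ler_pM2l // ler_pdivlMr // mulrC.
rewrite exchange_big /=.
apply: (@le_trans _ _ (\sum_(j < N) ((C / c * K * q%:R) / l ^+ 2))); last first.
  by rewrite sumr_const card_ord -[leLHS]mulr_natr.
rewrite big_mkcond /=; apply: ler_sum => j _.
have rhs0 : 0 <= (C / c * K * q%:R) / l ^+ 2.
  by rewrite !mulr_ge0 ?invr_ge0 ?sqr_ge0 // ltW.
case: ifP => // kj.
under eq_bigr do rewrite exprMn.
rewrite -mulr_sumr exprVn ler_pdivrMl ?exprn_gt0 //.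
rewrite [leRHS]mulrC divfK ?gt_eqF ?exprn_gt0 //.
have := @sum_kept_sqr R al be c (c / q%:R) P N x j
  [pred i : 'I_N | (k <= i < N - k)%N] al0 be0 c0 d0 hm hx.
move=> H; apply: le_trans (H _) _.
  move=> i /=; rewrite inE => /andP[ki iN].
  have kN : (k <= N)%N by rewrite (leq_trans ki) // ltnW.
  have [L1 L2] := mesh_lower hm c0 hx kN.
  have M1 := mesh_homo hm ki (ltnW (ltn_ord i)).
  have M2 := mesh_homo hm iN (leq_subr _ _).
  by split; lra.
have jk : sqnorm (jint (al + 1) (be + 1)) P j <= C * q%:R / N%:R.
  apply: le_trans (hC j) _; rewrite -mulrA ler_pM2l //.
  rewrite -[leRHS]invf_div lef_pV2 ?posrE ?divr_gt0 // ?ltr0n //.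
  by apply: le_trans Nk _; rewrite ler_nat leqW.
have NcK : 0 <= N%:R / c * K by rewrite mulr_ge0 // divr_ge0 // ltW.
rewrite -/K.
apply: le_trans (ler_wpM2l NcK jk) _.
rewrite le_eqVlt; apply/orP; left; apply/eqP; field.
by rewrite !gt_eqF.
Qed.

Theorem theorem4p13 (R : realType) (alpha beta : R)
    (halpha : 2^-1 < alpha) (hbeta : 2^-1 < beta)
    (P : nat -> {poly R}) (hP : jacobi_polynomials (alpha + 1) (beta + 1) P)
    (x : nat -> nat -> R) (hx : forall N, (1 < N)%N -> mesh N (x N))
    (hqu : quasi_uniform x)
    (gamma : R) (hgamma : 0 < gamma) :
  GLT0 (fun N : nat =>
    map_mx (real_complex R)
      ((ln N%:R `^ gamma)^-1 *: histopolation_mx alpha beta P N (x N))).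
Proof.
have al0 : 0 < alpha by rewrite (lt_trans _ halpha) // invr_gt0.
have be0 : 0 < beta by rewrite (lt_trans _ hbeta) // invr_gt0.
have [c [C' [c0 _ hqu']]] := hqu.
have hlow N i : (1 < N)%N -> (i < N)%N -> c / N%:R <= x N i.+1 - x N i.
  by move=> N1 iN; have /andP[] := hqu' N i N1 iN.
have al1 : 1 < alpha + 1 by rewrite ltrDr.
have be1 : 1 < beta + 1 by rewrite ltrDr.
have [C C0 hC] := sqnorm_bound al1 be1 hP.
apply: zero_distributed_lowrank_small => e e0.
(* The frame has rank at most 3 (N / q + 1), and each of the two terms is to be
   at most e N / 2. *)
pose q := (Num.truncn (6 / e)).+1.
have q6 : 6 / e < q%:R by exact: truncnS_gt.
(* The kept block has squared Frobenius norm at most M N / l^2 with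
   l = (log N)^gamma, and l >= T suffices to make this at most e N. *)
pose M := C / c * (2 `^ alpha * 2 `^ beta / (c / q%:R) ^+ 2) * q%:R.
have M0 : 0 <= M.
  by rewrite !mulr_ge0 ?powR_ge0 ?invr_ge0 ?sqr_ge0 // ltW.
pose T := 1 + M / e.
have T1 : 1 <= T by rewrite lerDl divr_ge0 // ltW.
near=> N.
have N1 : (1 < N)%N by near: N; exact: nbhs_infty_gt.
have N0 : (0 < N)%N by exact: ltnW.
have N0R : 0 < N%:R :> R by rewrite ltr0n.
have N6 : 6 / e <= N%:R by near: N; exact: nbhs_infty_ger.
have NT : expR (T `^ gamma^-1) <= N%:R by near: N; exact: nbhs_infty_ger.
set l := ln N%:R `^ gamma.
have lT : T <= l.
  have -> : T = (T `^ gamma^-1) `^ gamma.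
    by rewrite -powRrM mulVf ?gt_eqF // powRr1 // (le_trans ler01).
  have h : T `^ gamma^-1 <= ln N%:R by rewrite -ler_expR lnK // posrE.
  apply: ge0_ler_powR => //; rewrite ?nnegrE ?powR_ge0 //; first exact: ltW.
  exact: le_trans (powR_ge0 _ _) h.
have l0 : 0 < l by rewrite (lt_le_trans _ lT) // (lt_le_trans ltr01).
pose k := (N %/ q).+1.
pose H := histopolation_mx alpha beta P N (x N).
pose keep (i j : 'I_N) := (k <= i < N - k)%N && (k <= j)%N.
pose A0 : 'M[R]_N := \matrix_(i, j) if keep i j then (l^-1 *: H) i j else 0.
pose A := map_mx (real_complex R) A0.
pose Z := map_mx (real_complex R) (l^-1 *: H).
exists A, (Z - A); split.
- by rewrite addrC subrK.
- have rB : (\rank (Z - A)%R <= 3 * k)%N.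
    apply: mxrank_frame => i j ki kj.
    by rewrite !mxE /keep ki kj subrr.
  apply: (@le_trans _ _ (3 * k)%:R); first by rewrite ler_nat.
  have Nq : (N %/ q)%:R <= e * N%:R / 6.
    apply: (@le_trans _ _ (N%:R / q%:R)).
      by rewrite ler_pdivlMr ?ltr0n // -natrM ler_nat leq_divM.
    rewrite -mulrA mulrCA ler_pM2l //.
    rewrite -[leRHS]invf_div lef_pV2 ?posrE ?divr_gt0 ?ltr0n //.
    exact: ltW.
  move: N6; rewrite ler_pdivrMr // => N6.
  by rewrite natrM /k -natr1; lra.
- have -> : frobenius2 A = (\sum_(i < N | (k <= i < N - k)%N)
      \sum_(j < N | (k <= j)%N) (l^-1 * H i j) ^+ 2)%:C.
    rewrite /frobenius2 rmorph_sum /= [RHS]big_mkcond /=.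
    apply: eq_bigr => i _; rewrite rmorph_sum /=.
    have [ki|ki] := boolP (k <= i < N - k)%N; last first.
      rewrite big1 // => j _.
      by rewrite !mxE /keep (negbTE ki) /= normr0 expr0n.
    rewrite [RHS]big_mkcond /=; apply: eq_bigr => j _.
    rewrite !mxE /keep ki /=; case: ifP => _; last by rewrite normr0 expr0n.
    rewrite real_normK; last by apply/complex_realP; eexists.
    by rewrite -rmorphXn.
  rewrite lecR.
  apply: le_trans (kept_block_frobenius al0 be0 c0 C0 l0 (ltn0Sn _) N0
    (hx N N1) (fun i => hlow N i N1) hC erefl) _.
  rewrite -/M ler_pM2r // ler_pdivrMr ?exprn_gt0 // mulrC -ler_pdivrMr //.
  apply: (@le_trans _ _ T); first by rewrite lerDr.
  by apply: (le_trans lT); rewrite expr2 ler_peMr ?(ltW l0) // (le_trans T1).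
Unshelve. all: by end_near.
Qed.
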